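(* Let a combined non-degenerate finitely additive Markov chain be given on an arbitrary discrete space $(X,\Sigma_d)$, with Markov operator $A=A_{ca}+A_{pfa}$ and constants $q_1,q_2$, and suppose that $A_{ca}V_{pfa}\subset V_{ca}$. Then for such a Markov chain there exist invariant finitely additive probability measures $\mu^*=A\mu^*$, $\mu^*=\mu^*_{ca}+\mu^*_{pfa}$, and for the components of every such measure the following equalities hold: $$\|\mu^*_{ca}\|=\mu^*_{ca}(X)=q_1,\qquad \|\mu^*_{pfa}\|=\mu^*_{pfa}(X)=q_2.$$
   Context: ''Arbitrary discrete space'' $(X,\Sigma_d)$: $X$ is an infinite set, $\Sigma_d=2^X$ is the sigma-algebra of all subsets of $X$, and the cardinality of $X$ is ''immeasurable'', meaning that every finite countably additive measure on $2^X$ that is zero on every one-point set is identically zero. $B(X,\Sigma_d)$ is the space of bounded $\Sigma_d$-measurable functions $X\to\mathbb R$. $ba(X,\Sigma_d)$ and $ca(X,\Sigma_d)$ are the spaces of bounded real-valued finitely additive, respectively countably additive, measures on $\Sigma_d$, with the total variation norm. A finitely additive measure $\mu\ge0$ is purely finitely additive if every countably additive measure $\lambda$ with $0\le\lambda\le\mu$ is identically zero; a signed measure is purely finitely additive if both components of its Jordan decomposition are. $pfa(X,\Sigma_d)$ is the space of bounded purely finitely additive measures. Every $\mu\in ba(X,\Sigma_d)$ decomposes uniquely as $\mu=\mu_{ca}+\mu_{pfa}$ with $\mu_{ca}\in ca$, $\mu_{pfa}\in pfa$. For $\ast\in\{ba,ca,pfa\}$, $V_\ast$ is the set of nonnegative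 $\mu\in\ast(X,\Sigma_d)$ with $\mu(X)\le1$; a measure in $V_{ba}$ is a probability measure if $\mu(X)=1$. A finitely additive Markov chain is given by a finitely additive Markov kernel: a function $P(x,E)$, $x\in X$, $E\in\Sigma_d$, with $0\le P(x,E)\le1$, $P(\cdot,E)\in B(X,\Sigma_d)$ for all $E$, $P(x,\cdot)\in ba(X,\Sigma_d)$ and $P(x,X)=1$ for all $x$. It decomposes uniquely as $P(x,E)=P_{ca}(x,E)+P_{pfa}(x,E)$ with $P_{ca}(x,\cdot)\in ca(X,\Sigma_d)$, $P_{pfa}(x,\cdot)\in pfa(X,\Sigma_d)$ for all $x$. The operators on $ba(X,\Sigma_d)$ are $A\mu(E)=\int_X P(x,E)\,\mu(dx)$, $A_{ca}\mu(E)=\int_X P_{ca}(x,E)\,\mu(dx)$, $A_{pfa}\mu(E)=\int_X P_{pfa}(x,E)\,\mu(dx)$ (Radon integrals: the sup-norm continuous extension of the integral of simple functions), so $A=A_{ca}+A_{pfa}$. The chain is called combined if there are constants $0\le q_1,q_2\le1$, $q_1+q_2=1$, with $P_{ca}(x,X)=q_1$ and $P_{pfa}(x,X)=q_2$ for all $x\in X$; it is called non-degenerate if $0<q_1,q_2<1$. *)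

(* Defs.v *)
From mathcomp Require Import all_boot all_order all_algebra.
From mathcomp Require Import all_classical all_reals all_analysis.

Set Implicit Arguments.
Unset Strict Implicit.
Unset Printing Implicit Defensive.

Import Order.TTheory GRing.Theory Num.Theory.
Import numFieldNormedType.Exports.

Local Open Scope classical_set_scope.
Local Open Scope ring_scope.

(* The sigma-algebra is the full power set of X, so a real-valued set function
   on it is just a function [set X -> R], and every function [X -> R] is
   measurable: the bounded measurable functions are the bounded ones. *)
Section finitely_additive_measures.
Context {R : realType} {X : choiceType}.
Implicit Types (mu nu lam : set X -> R) (S : set (set X -> R)).

Definition finitely_additive mu :=
  forall A B, A `&` B = set0 -> mu (A `|` B) = mu A + mu B.

Definition countably_additive mu :=
  forall F : (set X)^nat, trivIset setT F ->
    series (fun n => mu (F n)) @ \oo --> mu (\bigcup_n F n).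

Definition nonneg mu := forall E, 0 <= mu E.

Definition ba : set (set X -> R) :=
  [set mu | finitely_additive mu /\ bounded_fun mu].

Definition ca : set (set X -> R) := [set mu | ba mu /\ countably_additive mu].

(* Components of the Jordan decomposition. *)
Definition pos_part mu : set X -> R :=
  fun E => sup [set mu F | F in [set F | F `<=` E]].

Definition neg_part mu : set X -> R := pos_part (\- mu).

Definition pfa_nonneg mu :=
  forall lam, ca lam -> (forall E, 0 <= lam E <= mu E) -> forall E, lam E = 0.

(* If mu >= 0, then [pos_part mu = mu] and [neg_part mu = 0]. *)
Definition pfa : set (set X -> R) :=
  [set mu | [/\ ba mu, pfa_nonneg (pos_part mu) & pfa_nonneg (neg_part mu)]].

Definition V S : set (set X -> R) :=
  [set mu | [/\ S mu, nonneg mu & mu setT <= 1]].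

Definition ca_pfa_decomposition mu mu_ca mu_pfa :=
  [/\ ca mu_ca, pfa mu_pfa & mu = mu_ca \+ mu_pfa].

Definition tv_norm mu : R :=
  sup [set v | exists (n : nat) (F : 'I_n -> set X),
         trivIset setT F /\ v = \sum_(i < n) `|mu (F i)|].

Definition simple_fun : set (X -> R) := [set s | finite_set (range s)].

Definition simple_integral mu (s : X -> R) : R :=
  \sum_(y \in [set: R]) y * mu (s @^-1` [set y]).

(* The continuous extension of [simple_integral mu], for uniform convergence,
   from the simple functions to the bounded functions, in which they are
   dense. *)
Definition radon_integral mu (f : X -> R) : R :=
  lim (simple_integral mu @ within simple_fun (nbhs (f : {uniform X -> R}))).

End finitely_additive_measures.

Definition immeasurable (R : realType) (X : choiceType) :=
  forall nu : set X -> R, ca nu -> nonneg nu ->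
    (forall x, nu [set x] = 0) -> forall E, nu E = 0.

Section finitely_additive_markov_chains.
Context {R : realType} {X : choiceType}.
Implicit Types (P P_ca P_pfa K : X -> set X -> R) (mu : set X -> R).

Definition fa_markov_kernel P :=
  [/\ forall x E, 0 <= P x E <= 1,
      forall E, bounded_fun (P^~ E),
      forall x, ba (P x) &
      forall x, P x setT = 1].

Definition kernel_op K mu : set X -> R :=
  fun E => radon_integral mu (fun x => K x E).

Definition kernel_decomposition P P_ca P_pfa :=
  forall x, ca_pfa_decomposition (P x) (P_ca x) (P_pfa x).

Definition combined P_ca P_pfa (q1 q2 : R) :=
  [/\ 0 <= q1 <= 1, 0 <= q2 <= 1, q1 + q2 = 1,
      forall x, P_ca x setT = q1 &
      forall x, P_pfa x setT = q2].

Definition non_degenerate (q1 q2 : R) := 0 < q1 < 1 /\ 0 < q2 < 1.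

Definition probability_measure mu := V ba mu /\ mu setT = 1.

Definition invariant_probability P mu :=
  probability_measure mu /\ mu = kernel_op P mu.

End finitely_additive_markov_chains.

(* Main.v *)
Require Import Defs.
From mathcomp Require Import all_boot all_order all_algebra.
From mathcomp Require Import all_classical all_reals all_analysis.
From mathcomp Require Import lra.
Import Order.TTheory GRing.Theory Num.Theory.
Import numFieldNormedType.Exports.
Local Open Scope classical_set_scope.
Local Open Scope ring_scope.
Set Implicit Arguments.
Unset Strict Implicit.
Unset Printing Implicit Defensive.

(** The proof rests on an explicit form of the decomposition
    [mu = mu_ca + mu_pfa] of a nonnegative finitely additive [mu].  When the
    cardinality of [X] is immeasurable, a countably additive measure without
    point masses vanishes ([ca_eq0]).  So a nonnegative [mu] is purely
    finitely additive exactly when it charges no point ([diffuse_pfa],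
    [pfa_set1]), and it is countably additive exactly when it is [tight], that
    is, carried up to any [e] by a finite set ([tight_ca], [ca_tight]).
    Consequently [mu_ca] is the supremum of [mu] over finite subsets
    ([atomic_part]), and both components are determined by [mu] and nonnegative
    ([decomposition_unique]).

    Let [mu] be invariant, so that [mu = A_ca mu + A_pfa mu].  The measures
    [P_pfa x] charge no point, hence neither does [A_pfa mu]: it is purely
    finitely additive whatever [mu] is.  In [A_ca mu = A_ca mu_ca + A_ca mu_pfa]
    the first term is tight, because tightness is preserved by integrating a
    family of tight measures against a tight one ([kernel_op_tight]), and the
    second is countably additive by assumption.  By uniqueness,
    [mu_ca = A_ca mu] and [mu_pfa = A_pfa mu], and the total masses of these are
    the integrals of the constants [q1] and [q2] against the probability [mu].

    For existence, let [L] be a Banach limit and let [mu_k] be the orbit of some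
    [P x0] under [A].  The set function [E |-> L (mu_k E)] is a finitely
    additive probability.  The integral of a bounded function commutes with [L]
    ([radon_limit]): for a simple function it is a finite sum, and
    uniform approximation is controlled by the total mass, which is 1 for all
    [k].  Hence [A] maps this set function to [E |-> L (mu_(k+1) E)], which is
    the same one by shift invariance. *)

(** * Simple and Radon integrals against a finitely additive measure *)

Section fa_measures.
Context {R : realType} {X : choiceType}.
Implicit Types (mu nu : set X -> R) (E F : set X) (f g s t : X -> R).

Definition fa_measure mu := finitely_additive mu /\ nonneg mu.

Lemma finitely_additive0 mu : finitely_additive mu -> mu set0 = 0.
Proof.
move=> fa; have := fa set0 set0 (setI0 _).
by rewrite setU0 => /eqP; rewrite -subr_eq0 opprD addNKr oppr_eq0 => /eqP.
Qed.

Lemma finitely_additive_setD mu E F : finitely_additive mu -> E `<=` F ->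
  mu F = mu E + mu (F `\` E).
Proof. by move=> fa EF; rewrite -fa ?setDIK// setDUK. Qed.

Lemma fa_measure_le mu E F : fa_measure mu -> E `<=` F -> mu E <= mu F.
Proof.
by move=> [fa mu0] EF; rewrite (finitely_additive_setD fa EF) lerDl.
Qed.

Lemma bounded_mapP (T : Type) (h : T -> R) :
  bounded_fun h <-> exists M, forall x, `|h x| <= M.
Proof.
split=> [[M [_ hM]]|[M hM]].
  by exists (M + 1) => x; apply: hM => //; rewrite ltrDl.
by exists M; split=> [|N MN x _]; [exact: num_real|exact: le_trans (ltW MN)].
Qed.

Lemma fa_measure_ba mu : fa_measure mu -> ba mu.
Proof.
move=> cmu; split; first exact: cmu.1.
apply/bounded_mapP; exists (mu setT) => E.
by rewrite ger0_norm ?fa_measure_le//; exact: cmu.2.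
Qed.

Lemma finitely_additive_bigsetU mu (T : eqType) (r : seq T) (p : pred T)
    (B : T -> set X) : finitely_additive mu -> uniq r ->
  (forall i j, i != j -> B i `&` B j = set0) ->
  mu (\big[setU/set0]_(i <- r | p i) B i) = \sum_(i <- r | p i) mu (B i).
Proof.
move=> fa + dB; elim: r => [|i r IHr] /= => [_|/andP[ir ur]].
  by rewrite !big_nil finitely_additive0.
rewrite !big_cons; case: ifP => _; rewrite ?IHr// -IHr// fa//.
rewrite big_distrr/= big_seq_cond big1// => j /andP[jr _].
by apply: dB; apply: contraNneq ir => ->.
Qed.

(** Regrouping the sum over any finite partition on which the integrand is
    constant.  Partitions finer than the level sets let two simple functions be
    compared or added through the pair of their values. *)
Lemma simple_integral_comp mu (T : choiceType) (g : X -> T) (h : T -> R)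
    (r : seq T) : finitely_additive mu -> uniq r -> (forall x, g x \in r) ->
  simple_integral mu (h \o g) = \sum_(i <- r) h i * mu (g @^-1` [set i]).
Proof.
move=> fa ur gr.
rewrite /simple_integral (fsbigE (undup [seq h i | i <- r])); first last.
- move=> y _ /negP yr; rewrite (_ : _ @^-1` _ = set0) ?finitely_additive0 ?mulr0//.
  rewrite -subset0 => x /= xy; apply: yr.
  by rewrite mem_undup -xy; exact: map_f.
- by [].
- exact: undup_uniq.
rewrite (eq_bigl xpredT); last by move=> y; rewrite in_setT.
transitivity (\sum_(y <- undup [seq h i | i <- r])
    \sum_(i <- r | h i == y) h i * mu (g @^-1` [set i])).
  apply: eq_bigr => y _.
  rewrite (_ : (h \o g) @^-1` [set y] =
      \big[setU/set0]_(i <- r | h i == y) (g @^-1` [set i])); last first.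
    apply/seteqP; split=> x /=; rewrite -bigcup_seq_cond/=.
      by move=> hy; exists (g x) => //=; rewrite gr hy eqxx.
    by move=> [i /= /andP[_ /eqP <-] ->].
  rewrite finitely_additive_bigsetU//; last first.
    move=> i j /eqP ij; rewrite -subset0 => x [/= gi gj]; apply: ij.
    by rewrite -gi -gj.
  by rewrite mulr_sumr; apply: eq_bigr => i /eqP ->.
under eq_bigr do rewrite big_mkcond.
rewrite exchange_big/= big_seq [RHS]big_seq; apply: eq_bigr => i ir.
rewrite (bigD1_seq (h i)) ?undup_uniq//=; last first.
  by rewrite mem_undup map_f.
rewrite eqxx big1_seq ?addr0// => y /andP[].
by rewrite eq_sym => /negPf ->.
Qed.

(** The list [r] does not depend on [mu], so that identities between integrals
    against several measures reduce to identities between finite sums. *)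
Lemma simple_integral_range s : finite_set (range s) ->
  exists2 r : seq R, uniq r & forall mu, finitely_additive mu ->
    simple_integral mu s = \sum_(y <- r) y * mu (s @^-1` [set y]).
Proof.
move=> /finite_seqP[r sr]; exists (undup r) => [|mu fa]; first exact: undup_uniq.
apply: (simple_integral_comp id) => //; first exact: undup_uniq.
move=> x; rewrite mem_undup.
by have : range s (s x) by [exists x]; rewrite sr.
Qed.

Lemma simple_pair s t : simple_fun s -> simple_fun t ->
  exists2 r : seq (R * R), uniq r & forall x, (s x, t x) \in r.
Proof.
move=> /finite_seqP[r1 sr] /finite_seqP[r2 tr].
exists (undup [seq (y, z) | y <- r1, z <- r2]); first exact: undup_uniq.
move=> x; rewrite mem_undup; apply: allpairs_f.
  by have : range s (s x) by [exists x]; rewrite sr.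
by have : range t (t x) by [exists x]; rewrite tr.
Qed.

Lemma simple_funD s t : simple_fun s -> simple_fun t -> simple_fun (s \+ t).
Proof.
move=> fs ft; have [r _ rst] := simple_pair fs ft.
apply: (@sub_finite_set _ _ [set` [seq y.1 + y.2 | y <- r]]) => // _ [x _ <-].
by apply/mapP; exists (s x, t x).
Qed.

Lemma simple_fun_cst (c : R) : @simple_fun R X (cst c).
Proof.
by apply: (@sub_finite_set _ _ [set c]); [move=> _ [x _ <-]|exact: finite_set1].
Qed.

Lemma simple_integralD mu s t : finitely_additive mu ->
  simple_fun s -> simple_fun t ->
  simple_integral mu (s \+ t) = simple_integral mu s + simple_integral mu t.
Proof.
move=> fa fs ft; have [r ur rst] := simple_pair fs ft.
rewrite (simple_integral_comp (fun y => y.1 + y.2) fa ur rst).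
rewrite (simple_integral_comp (fst) fa ur rst).
rewrite (simple_integral_comp (snd) fa ur rst) -big_split/=.
by apply: eq_bigr => y _; rewrite mulrDl.
Qed.

Lemma simple_integral_cst mu (c : R) : finitely_additive mu ->
  simple_integral mu (cst c) = c * mu setT.
Proof.
move=> fa; have := @simple_integral_comp mu R (cst c) id [:: c] fa erefl.
rewrite big_seq1 preimage_cst mem_set//; apply.
by move=> x; rewrite inE.
Qed.

Lemma simple_integral_le mu s t : fa_measure mu ->
  simple_fun s -> simple_fun t -> (forall x, s x <= t x) ->
  simple_integral mu s <= simple_integral mu t.
Proof.
move=> [fa mu0] fs ft st; have [r ur rst] := simple_pair fs ft.
rewrite (simple_integral_comp (fst) fa ur rst).
rewrite (simple_integral_comp (snd) fa ur rst).
apply: ler_sum => -[y z] _ /=.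
have [->|/set0P[x [<- <-]]] := eqVneq ((fun x => (s x, t x)) @^-1` [set (y, z)]) set0.
  by rewrite finitely_additive0// !mulr0.
by rewrite ler_wpM2r// mu0.
Qed.

Lemma simple_integral_leD mu s t (e : R) : fa_measure mu ->
  simple_fun s -> simple_fun t -> (forall x, s x <= t x + e) ->
  simple_integral mu s <= simple_integral mu t + e * mu setT.
Proof.
move=> cmu fs ft st; have fa := cmu.1.
rewrite -simple_integral_cst// -simple_integralD//; last exact: simple_fun_cst.
apply: simple_integral_le => //.
by apply: simple_funD => //; exact: simple_fun_cst.
Qed.

Lemma simple_approx f (e : R) : bounded_fun f -> 0 < e ->
  exists2 s, simple_fun s & forall x, `|f x - s x| <= e.
Proof.
move=> /bounded_mapP[M fM] e0.
have M0 x : 0 <= (f x + M) / e.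
  by apply: divr_ge0; last exact: ltW; have := fM x; rewrite ler_norml => /andP[]; lra.
pose N := (Num.truncn (2 * M / e)).+1.
(* Round down to the grid of step e; the shift by M makes the argument of
   truncn nonnegative. *)
exists (fun x => e * (Num.truncn ((f x + M) / e))%:R - M).
  apply: (@sub_finite_set _ _ [set e * k%:R - M | k in `I_N]); last first.
    by apply: finite_image; exact: finite_II.
  move=> _ [x _ <-] /=; exists (Num.truncn ((f x + M) / e)) => //.
  rewrite /N ltnS le_truncn// ler_pM2r ?invr_gt0//.
  by have := fM x; rewrite ler_norml => /andP[]; lra.
move=> x; have /andP[] := truncn_itv (M0 x).
rewrite ler_pdivlMr// ltr_pdivrMr// -natr1 => h1 h2.
by rewrite ler_norml; apply/andP; split; nra.
Qed.

(** The only access to the limit in the definition of the integral: for a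
    nonnegative [mu], simple functions at uniform distance at most [d] have
    integrals at distance at most [d * mu setT], so one good simple function at
    each scale determines the limit; its existence also makes the filter proper. *)
Lemma radon_unique mu f (C I : R) : fa_measure mu ->
  (forall e, 0 < e -> exists s, [/\ simple_fun s, forall x, `|f x - s x| <= e
     & `|simple_integral mu s - I| <= C * e]) ->
  radon_integral mu f = I.
Proof.
move=> cmu H.
have near_f e : 0 < e -> nbhs (f : {uniform X -> R}) [set g | forall x, `|f x - g x| < e].
  move=> e0; apply/uniform_nbhs.
  exists [set xy | `|xy.1 - xy.2| < e]; split; last by move=> g /= + x; exact.
  by rewrite -entourage_ballE; exists e.
have FF : ProperFilter (within simple_fun (nbhs (f : {uniform X -> R}))).
  split; last exact: within_filter.
  rewrite /within /= => /uniform_nbhs[E [+ sE]].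
  rewrite -entourage_ballE => -[e e0 eE].
  have [|s [ss fs _]] := H (e / 2); first by rewrite divr_gt0.
  apply: (sE s) => //= x _; apply: eE => /=.
  by rewrite /ball/=; apply: le_lt_trans (fs x) _; rewrite ltr_pdivrMr// ltr_pMr// ltr1n.
apply/cvg_lim => //; apply/cvgrPdist_le => /= e e0.
have m0 : 0 <= mu setT by exact: cmu.2.
have C0 : 0 < 2 * mu setT + `|C| + 1 by have := normr_ge0 C; lra.
pose d := e / (2 * mu setT + `|C| + 1).
have d0 : 0 < d by rewrite divr_gt0.
have de : e = d * (2 * mu setT + `|C| + 1) by rewrite divfK ?gt_eqF.
have [s [ss fs sI]] := H d d0.
apply: filterS (near_f d d0) => g /= fg gs.
have st x : g x <= s x + 2 * d.
  by have := fg x; have := fs x; rewrite ler_norml ltr_norml => /andP[? ?] /andP[]; lra.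
have ts x : s x <= g x + 2 * d.
  by have := fg x; have := fs x; rewrite ler_norml ltr_norml => /andP[? ?] /andP[]; lra.
have := simple_integral_leD cmu gs ss st.
have := simple_integral_leD cmu ss gs ts.
move: sI; rewrite !ler_norml => /andP[? ?] ? ?.
have := ler_norm C => ?; rewrite de; apply/andP; split; nra.
Qed.

(** The limit exists: the intervals of centre [simple_integral mu s] and radius
    [e * mu setT], for [s] within [e] of [f], meet pairwise, so the supremum of
    their left ends lies in all of them. *)
Lemma radon_approx mu f s (e : R) : fa_measure mu -> bounded_fun f ->
  simple_fun s -> (forall x, `|f x - s x| <= e) ->
  `|simple_integral mu s - radon_integral mu f| <= mu setT * e.
Proof.
move=> cmu bf.
pose lower := [set v | exists s e, [/\ simple_fun s, forall x, `|f x - s x| <= e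
  & v = simple_integral mu s - e * mu setT]].
have lower_le t d : simple_fun t -> (forall x, `|f x - t x| <= d) ->
    ubound lower (simple_integral mu t + d * mu setT).
  move=> ts ft _ [s' [e' [ss' fs' ->]]].
  rewrite lerBlDr -addrA -mulrDl; apply: simple_integral_leD => // x.
  move: (fs' x) (ft x); rewrite !ler_norml => /andP[? ?] /andP[? ?]; lra.
have lower_ge t d : simple_fun t -> (forall x, `|f x - t x| <= d) ->
    lower (simple_integral mu t - d * mu setT) by move=> ts ft; exists t, d.
have supP t d : simple_fun t -> (forall x, `|f x - t x| <= d) ->
    `|simple_integral mu t - sup lower| <= mu setT * d.
  move=> ts ft; have lt := lower_ge _ _ ts ft; have ut := lower_le _ _ ts ft.
  have : simple_integral mu t - d * mu setT <= sup lower.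
    by apply: ub_le_sup => //; exists (simple_integral mu t + d * mu setT).
  have : sup lower <= simple_integral mu t + d * mu setT.
    by apply: ge_sup => //; exists (simple_integral mu t - d * mu setT).
  by rewrite ler_norml mulrC => ? ?; apply/andP; split; lra.
rewrite (@radon_unique _ _ (mu setT) (sup lower))//; first exact: supP.
move=> d d0; have [t ts ft] := simple_approx bf d0.
by exists t; split=> //; exact: supP.
Qed.

Lemma radonD mu f g : fa_measure mu -> bounded_fun f -> bounded_fun g ->
  radon_integral mu (f \+ g) = radon_integral mu f + radon_integral mu g.
Proof.
move=> cmu bf bg; apply: (@radon_unique _ _ (mu setT)) => // e e0.
have e20 : 0 < e / 2 by rewrite divr_gt0.
have [s ss fs] := simple_approx bf e20.
have [t ts gt] := simple_approx bg e20.
exists (s \+ t); split; [exact: simple_funD| |].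
  move=> x /=; move: (fs x) (gt x).
  by rewrite !ler_norml => /andP[? ?] /andP[? ?]; apply/andP; split; lra.
have fa := cmu.1; rewrite simple_integralD//.
have := radon_approx cmu bf ss fs; have := radon_approx cmu bg ts gt.
rewrite !ler_norml => /andP[? ?] /andP[? ?]; apply/andP; split; lra.
Qed.

Lemma radon_simple mu s : fa_measure mu -> simple_fun s ->
  radon_integral mu s = simple_integral mu s.
Proof.
move=> cmu ss; apply: (@radon_unique _ _ 0) => // e e0; exists s; split=> //.
  by move=> x; rewrite subrr normr0 ltW.
by rewrite subrr normr0 mul0r.
Qed.

Lemma bounded_fun_cst (c : R) : bounded_fun (cst c : X -> R).
Proof. by apply/bounded_mapP; exists `|c|. Qed.

Lemma radon_cst mu (c : R) : fa_measure mu -> radon_integral mu (cst c) = c * mu setT.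
Proof.
move=> cmu; rewrite radon_simple//; last exact: simple_fun_cst.
by rewrite simple_integral_cst//; exact: cmu.1.
Qed.

Lemma radon_le mu f g : fa_measure mu -> bounded_fun f -> bounded_fun g ->
  (forall x, f x <= g x) -> radon_integral mu f <= radon_integral mu g.
Proof.
move=> cmu bf bg fg; apply/ler_addgt0Pr => e e0.
have m0 : 0 <= mu setT by exact: cmu.2.
pose d := e / (4 * mu setT + 1).
have d0 : 0 < d by rewrite divr_gt0//; lra.
have de : e = d * (4 * mu setT + 1) by rewrite divfK ?gt_eqF//; lra.
have [s ss fs] := simple_approx bf d0.
have [t ts gt] := simple_approx bg d0.
have := @simple_integral_leD mu s t (2 * d) cmu ss ts.
have st x : s x <= t x + 2 * d.
  move: (fs x) (gt x) (fg x); rewrite !ler_norml => /andP[? ?] /andP[? ?] ?; lra.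
move=> /(_ st).
have := radon_approx cmu bf ss fs; have := radon_approx cmu bg ts gt.
rewrite !ler_norml => /andP[? ?] /andP[? ?] ?; rewrite de; nra.
Qed.

Lemma fa_measureD mu nu : fa_measure mu -> fa_measure nu -> fa_measure (mu \+ nu).
Proof.
move=> [fa m0] [fb n0]; split=> [A B AB|E] /=; last by rewrite addr_ge0.
by rewrite fa// fb// addrACA.
Qed.

Lemma radon_measureD mu nu f : fa_measure mu -> fa_measure nu -> bounded_fun f ->
  radon_integral (mu \+ nu) f = radon_integral mu f + radon_integral nu f.
Proof.
move=> cmu cnu bf; have cmn := fa_measureD cmu cnu.
apply: (@radon_unique _ _ (mu setT + nu setT)) => // e e0.
have [s ss fs] := simple_approx bf e0; exists s; split=> //.
have [r ur sr] := simple_integral_range ss.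
have -> : simple_integral (mu \+ nu) s = simple_integral mu s + simple_integral nu s.
  rewrite (sr _ cmn.1) (sr _ cmu.1) (sr _ cnu.1) -big_split/=.
  by apply: eq_bigr => y _; rewrite mulrDr.
have := radon_approx cmu bf ss fs; have := radon_approx cnu bf ss fs.
rewrite !ler_norml => /andP[? ?] /andP[? ?]; apply/andP; split; lra.
Qed.

Lemma radon_scale_indic mu (c : R) E : fa_measure mu ->
  radon_integral mu (fun x => c * \1_E x) = c * mu E.
Proof.
move=> cmu; have sE : simple_fun (fun x => c * \1_E x).
  apply: (@sub_finite_set _ _ [set c * (b : nat)%:R | b in [set: bool]]).
    by move=> _ [x _ <-]; exists (x \in E).
  exact: finite_image.
rewrite radon_simple//.
rewrite (@simple_integral_comp mu bool (fun x => x \in E) (fun b => c * (b : nat)%:R)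
  [:: false; true])//; [|exact: cmu.1|by move=> x; case: (x \in E)].
rewrite big_cons big_seq1 mulr0 mul0r add0r mulr1; congr (_ * mu _).
by apply/seteqP; split => x /=; [move/set_mem|move/mem_set].
Qed.

End fa_measures.

(** * Atomic and diffuse parts *)

Section yosida_hewitt.
Context {R : realType} {X : choiceType}.
Implicit Types (mu nu : set X -> R) (E F G : set X) (J : set (set X)).

Lemma baD mu nu : ba mu -> ba nu -> ba (mu \+ nu).
Proof.
move=> [fm /bounded_mapP[M hM]] [fn /bounded_mapP[N hN]]; split.
  by move=> A B AB /=; rewrite fm// fn// addrACA.
apply/bounded_mapP; exists (M + N) => E.
by apply: le_trans (ler_normD _ _) _; rewrite lerD.
Qed.

Lemma baN mu : ba mu -> ba (\- mu).
Proof.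
move=> [fm /bounded_mapP[M hM]]; split.
  by move=> A B AB /=; rewrite fm// opprD.
by apply/bounded_mapP; exists M => E /=; rewrite normrN.
Qed.

Lemma caD mu nu : ca mu -> ca nu -> ca (mu \+ nu).
Proof.
move=> [bm cm] [bn cn]; split=> [|F tF]; first exact: baD.
rewrite (_ : series _ = series (fun n => mu (F n)) \+ series (fun n => nu (F n))).
  by apply: cvgD; [exact: cm|exact: cn].
by apply/funext => n; rewrite /series/= -big_split.
Qed.

Lemma caN mu : ca mu -> ca (\- mu).
Proof.
move=> [bm cm]; split=> [|F tF]; first exact: baN.
rewrite (_ : series _ = \- series (fun n => mu (F n))).
  by apply: cvgN; exact: cm.
by apply/funext => n; rewrite /series/= sumrN.
Qed.

(** By monotonicity the partial sums never exceed the measure of the union, so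
    a lower bound suffices. *)
Lemma fa_measure_countably_additive mu : fa_measure mu ->
  (forall F : (set X)^nat, trivIset setT F -> forall e, 0 < e ->
     exists N, mu (\bigcup_n F n) - e <= \sum_(n < N) mu (F n)) ->
  countably_additive mu.
Proof.
move=> cmu approx F tF.
have series_le N : \sum_(0 <= n < N) mu (F n) <= mu (\bigcup_n F n).
  rewrite -finitely_additive_bigsetU ?iota_uniq//; [|exact: cmu.1|].
    apply: fa_measure_le => //; rewrite -bigcup_seq => x [n _ Fnx]; by exists n.
  move=> i j /eqP ij; apply: contrapT => /eqP/set0P ne.
  by apply: ij; apply: tF.
apply/cvgrPdist_le => e e0; have [N hN] := approx F tF e e0.
near=> n.
have Nn : (N <= n)%N by near: n; exact: nbhs_infty_ge.
have : \sum_(0 <= k < N) mu (F k) <= \sum_(0 <= k < n) mu (F k).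
  by rewrite [leRHS](big_cat_nat (n := N))//= lerDl sumr_ge0// => k _; exact: cmu.2.
have := series_le n; rewrite /series/= -(big_mkord xpredT (fun k => mu (F k))) in hN *.
by move=> ? ?; rewrite ler_norml; apply/andP; split; lra.
Unshelve. all: by end_near. Qed.

(** With [J] the ideal of all sets this is the positive part of [mu]; with [J]
    the ideal of finite sets it is the part of [mu] carried by points. *)
Definition inner_sup J mu E := sup [set mu F | F in [set F | J F /\ F `<=` E]].

Definition ideal J := [/\ J set0, (forall E F, J F -> E `<=` F -> J E) &
  (forall E F, J E -> J F -> J (E `|` F))].

Lemma ideal_setT : ideal (@setT (set X)). Proof. by split. Qed.

Lemma ideal_finite : ideal (@finite_set X).
Proof.
split=> [|E F fF EF|E F fE fF]; first exact: finite_set0.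
  exact: sub_finite_set fF.
by rewrite finite_setU.
Qed.

Lemma pos_partE mu : pos_part mu = inner_sup setT mu.
Proof.
apply/funext => E; rewrite /pos_part /inner_sup; congr sup.
by apply/seteqP; split=> _ [F /= H <-]; exists F => //; case: H.
Qed.

Section inner_sup.
Context (J : set (set X)) (mu : set X -> R) (iJ : ideal J) (bmu : ba mu).

Lemma inner_sup_ge E F : J F -> F `<=` E -> mu F <= inner_sup J mu E.
Proof.
move=> JF FE; have /bounded_mapP[M hM] := bmu.2; apply: ub_le_sup; last by exists F.
by exists M => _ [G _ <-]; exact: le_trans (ler_norm _) (hM G).
Qed.

Lemma inner_sup_le E (c : R) : (forall F, J F -> F `<=` E -> mu F <= c) ->
  inner_sup J mu E <= c.
Proof.
move=> h; apply: ge_sup => [|_ [F [JF FE] <-]]; last exact: h.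
by case: iJ => J0 _ _; exists (mu set0), set0 => //; split=> //; exact: sub0set.
Qed.

(** Additivity: stability of [J] under subsets lets one cut a set inside
    [A `|` B] into a part in [A] and a part in [B], and stability under unions
    lets one glue such parts. *)
Lemma inner_sup_fa_measure : fa_measure (inner_sup J mu).
Proof.
have [J0 Jsub JU] := iJ; have [fmu _] := bmu; split; last first.
  by move=> E; rewrite -(finitely_additive0 fmu) inner_sup_ge.
move=> A B AB; apply/eqP; rewrite eq_le; apply/andP; split.
  apply: inner_sup_le => F JF FAB.
  rewrite -(setIidl FAB) setIUr fmu; last by rewrite setIACA AB setI0.
  by apply: lerD; apply: inner_sup_ge; (try exact: Jsub JF (@subIsetl _ _ _)); exact: subIsetr.
rewrite -lerBrDr; apply: inner_sup_le => F JF FA.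
rewrite lerBrDr addrC -lerBrDr; apply: inner_sup_le => G JG GB.
rewrite lerBrDr addrC -fmu; last by rewrite -subset0 -AB; exact: setISS.
by apply: inner_sup_ge; [exact: JU|exact: setUSS].
Qed.

Lemma inner_sup_id E : fa_measure mu -> J E -> inner_sup J mu E = mu E.
Proof.
move=> cmu JE; apply/eqP; rewrite eq_le inner_sup_ge// andbT.
by apply: inner_sup_le => F _; exact: fa_measure_le.
Qed.

Lemma inner_sup_le_fa_measure E : fa_measure mu -> inner_sup J mu E <= mu E.
Proof. by move=> cmu; apply: inner_sup_le => F _; exact: fa_measure_le. Qed.

End inner_sup.

(** A set [G] nearly realizing the supremum on the union is cut by the [F n]
    into pieces whose measures sum to that of [G], each at most the positive
    part of [F n]. *)
Lemma ca_pos_part mu : ca mu -> ca (pos_part mu).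
Proof.
move=> [bmu cmu]; rewrite pos_partE.
have cp := inner_sup_fa_measure ideal_setT bmu.
split; first exact: fa_measure_ba.
apply: fa_measure_countably_additive => // F tF e e0.
set p := inner_sup setT mu.
have [G [GF pG]] : exists G, G `<=` \bigcup_n F n /\ p (\bigcup_n F n) - e / 2 <= mu G.
  apply: contrapT => nG; suff : p (\bigcup_n F n) <= p (\bigcup_n F n) - e / 2 by lra.
  apply: (inner_sup_le ideal_setT) => G _ GF; rewrite leNgt; apply/negP => /ltW lG.
  by apply: nG; exists G.
have tG : trivIset setT (fun n => G `&` F n).
  by apply: sub_trivIset (@trivIset_setIl _ _ setT F (fun=> G) tF).
have := cmu _ tG; rewrite -setI_bigcupr (setIidl GF) => /cvgrPdist_le /(_ (e / 2)).
rewrite divr_gt0// => /(_ erefl) [N _ /(_ N (leqnn N))] /=.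
rewrite /series/= big_mkord ler_norml => /andP[_ hN]; exists N.
have : \sum_(n < N) mu (G `&` F n) <= \sum_(n < N) p (F n).
  by apply: ler_sum => n _; apply: inner_sup_ge => //; exact: subIsetr.
lra.
Qed.

Lemma pos_part_set1 mu x : ba mu -> mu [set x] = 0 -> pos_part mu [set x] = 0.
Proof.
move=> bmu mx; have cp := inner_sup_fa_measure ideal_setT bmu.
apply/eqP; rewrite pos_partE eq_le cp.2 andbT.
apply: (inner_sup_le ideal_setT) => F _ /subset_set1[] -> //.
  by rewrite finitely_additive0//; exact: bmu.1.
by rewrite mx.
Qed.

(** Immeasurability, stated for nonnegative measures, extends to signed ones
    through the positive parts of [mu] and of its opposite. *)
Lemma ca_eq0 mu : immeasurable R X -> ca mu -> (forall x, mu [set x] = 0) ->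
  forall E, mu E = 0.
Proof.
move=> immX; suff le0 nu : ca nu -> (forall x, nu [set x] = 0) -> forall E, nu E <= 0.
  move=> cmu mu1 E; apply/eqP; rewrite eq_le le0//= -oppr_le0.
  by apply: (le0 (\- mu)); [exact: caN|move=> x /=; rewrite mu1 oppr0].
move=> cnu nu1 E; have bnu := cnu.1.
rewrite -(immX (pos_part nu) (ca_pos_part cnu) _ _ E).
- by rewrite pos_partE; exact: inner_sup_ge.
- by rewrite pos_partE; exact: (inner_sup_fa_measure ideal_setT bnu).2.
- by move=> x; exact: pos_part_set1.
Qed.

Definition tight mu := forall e, 0 < e -> exists2 F, finite_set F & mu (~` F) <= e.

(** A finite set meets only finitely many of the disjoint sets [F n], and what
    lies outside it is negligible. *)
Lemma tight_ca mu : fa_measure mu -> tight mu -> ca mu.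
Proof.
move=> cmu tmu; split; first exact: fa_measure_ba.
apply: fa_measure_countably_additive => // F tF e /tmu[G fG Ge].
have [N GN] : exists N, G `&` \bigcup_n F n `<=` \big[setU/set0]_(n < N) F n.
  have /finite_seqP[r Gr] : finite_set (G `&` \bigcup_n F n) by exact: finite_setIl.
  have : forall x, exists n, x \in r -> F n x.
    move=> x; have [xr|_] := boolP (x \in r); last by exists 0%N.
    have : [set` r] x by []. 
    by rewrite -Gr => -[_ [n _ Fnx]]; exists n.
  move=> /choice[n Fn]; exists (\max_(x <- r) n x).+1 => x; rewrite Gr => /= xr.
  rewrite -bigcup_mkord; exists (n x); last exact: Fn.
  by rewrite /= ltnS; apply: leq_bigmax_seq.
exists N; rewrite -(finitely_additive_bigsetU xpredT cmu.1) ?index_enum_uniq//; last first.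
  move=> i j /eqP ij; apply: contrapT => /eqP/set0P ne.
  by apply: ij; apply: val_inj; apply: tF.
have sub : \big[setU/set0]_(n < N) F n `<=` \bigcup_n F n.
  by rewrite -bigcup_mkord => x [n _ Fnx]; exists n.
rewrite (finitely_additive_setD cmu.1 sub) lerBlDr lerD2l; apply: le_trans Ge.
by apply: fa_measure_le => // x [Ux nx] Gx; apply: nx; apply: GN.
Qed.

Definition atomic_part mu := inner_sup finite_set mu.

Lemma atomic_part_fa_measure mu : fa_measure mu -> fa_measure (atomic_part mu).
Proof. by move=> /fa_measure_ba bmu; exact: inner_sup_fa_measure ideal_finite bmu. Qed.

Lemma atomic_part1 mu x : fa_measure mu -> atomic_part mu [set x] = mu [set x].
Proof.
move=> cmu; by apply: inner_sup_id => //; [exact: ideal_finite|exact: fa_measure_ba].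
Qed.

Lemma atomic_part_tight mu : fa_measure mu -> tight (atomic_part mu).
Proof.
move=> cmu e e0; have bmu := fa_measure_ba cmu; have cat := atomic_part_fa_measure cmu.
apply: contrapT => nF.
suff : atomic_part mu setT <= atomic_part mu setT - e by lra.
apply: (inner_sup_le ideal_finite) => F fF _; rewrite leNgt; apply/negP => lF.
apply: nF; exists F => //.
have := finitely_additive_setD cat.1 (@subsetT _ F); rewrite setTD.
have := @inner_sup_id _ _ ideal_finite bmu F cmu fF; rewrite -/(atomic_part mu).
lra.
Qed.

Lemma diffuse_part_fa_measure mu : fa_measure mu -> fa_measure (mu \- atomic_part mu).
Proof.
move=> cmu; split=> [A B AB|E] /=; last first.
  by rewrite subr_ge0 inner_sup_le_fa_measure//; exact: ideal_finite.
by rewrite cmu.1// (atomic_part_fa_measure cmu).1// opprD addrACA.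
Qed.

Lemma fa_measure_pos_part mu : fa_measure mu -> pos_part mu = mu.
Proof.
move=> cmu; apply/funext => E; rewrite pos_partE inner_sup_id//.
exact: fa_measure_ba.
Qed.

Lemma fa_measure_neg_part mu : fa_measure mu -> neg_part mu = cst 0.
Proof.
move=> cmu; have bN := baN (fa_measure_ba cmu).
apply/funext => E; rewrite /neg_part pos_partE; apply/eqP; rewrite eq_le.
rewrite (inner_sup_fa_measure ideal_setT bN).2 andbT.
by apply: (inner_sup_le ideal_setT) => F _ _ /=; rewrite oppr_le0; exact: cmu.2.
Qed.

(** A countably additive measure below [mu] inherits the absence of point
    masses, hence vanishes. *)
Lemma diffuse_pfa mu : immeasurable R X -> fa_measure mu ->
  (forall x, mu [set x] = 0) -> pfa mu.
Proof.
move=> immX cmu mu1; split; first exact: fa_measure_ba.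
  rewrite fa_measure_pos_part// => lam clam lam_le.
  apply: immX => // [E|x]; first by case/andP: (lam_le E).
  by apply/eqP; rewrite eq_le andbC -{2}(mu1 x).
rewrite fa_measure_neg_part// => lam _ lam_le E.
by apply/eqP; rewrite eq_le andbC.
Qed.

(** Otherwise the restriction of [mu] to the point [x] would be a nonzero
    countably additive measure below [mu]. *)
Lemma pfa_nonneg_set1 mu x : fa_measure mu -> pfa_nonneg mu -> mu [set x] = 0.
Proof.
move=> cmu pmu; pose lam E : R := mu (E `&` [set x]).
have clam : fa_measure lam.
  split=> [A B AB|E]; last exact: cmu.2.
  by rewrite /lam setIUl cmu.1// setIACA AB set0I.
rewrite -[LHS](_ : lam [set x] = _); last by rewrite /lam setIid.
apply: pmu => [|E]; last first.
  by rewrite clam.2/=; exact: fa_measure_le cmu (@subIsetl _ _ _).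
apply: tight_ca => // e e0; exists [set x]; first exact: finite_set1.
by rewrite /lam setICl finitely_additive0 ?ltW//; exact: cmu.1.
Qed.

Lemma pfa_set1 mu x : pfa mu -> mu [set x] = 0.
Proof.
move=> [bmu pp pn].
have := @pfa_nonneg_set1 _ x _ pp; rewrite pos_partE.
move/(_ (inner_sup_fa_measure ideal_setT bmu)) => p0.
have := @pfa_nonneg_set1 _ x _ pn; rewrite /neg_part pos_partE.
move/(_ (inner_sup_fa_measure ideal_setT (baN bmu))) => n0.
apply/eqP; rewrite eq_le -{1}p0 inner_sup_ge//= -oppr_le0 -n0.
by apply: (inner_sup_ge (baN bmu)).
Qed.

Lemma decomposition_atomic mu : immeasurable R X -> fa_measure mu ->
  ca_pfa_decomposition mu (atomic_part mu) (mu \- atomic_part mu).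
Proof.
move=> immX cmu; split.
- apply: tight_ca; [exact: atomic_part_fa_measure|exact: atomic_part_tight].
- apply: diffuse_pfa => // [|x]; first exact: diffuse_part_fa_measure.
  by rewrite /= atomic_part1// subrr.
- by apply/funext => E /=; rewrite addrC subrK.
Qed.

(** [mu_ca] and [mu_pfa] may be signed here; their nonnegativity is part of what
    is obtained.  The difference of [mu_ca] and the atomic part is countably
    additive and charges no point. *)
Lemma decomposition_unique mu mu_ca mu_pfa : immeasurable R X -> fa_measure mu ->
  ca_pfa_decomposition mu mu_ca mu_pfa ->
  mu_ca = atomic_part mu /\ mu_pfa = mu \- atomic_part mu.
Proof.
move=> immX cmu [cca cpfa mE]; have [cat _ _] := decomposition_atomic immX cmu.
have e : mu_ca = atomic_part mu.
  apply/funext => E; apply/eqP; rewrite -subr_eq0; apply/eqP.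
  apply: (ca_eq0 immX (caD cca (caN cat))) => x /=.
  by rewrite atomic_part1// mE/= (pfa_set1 x cpfa) addr0 subrr.
split=> //; apply/funext => E /=; rewrite -e mE /=.
by rewrite addrC addKr.
Qed.

Lemma ca_tight mu : immeasurable R X -> fa_measure mu -> ca mu -> tight mu.
Proof.
move=> immX cmu cam.
have cat := tight_ca (atomic_part_fa_measure cmu) (atomic_part_tight cmu).
suff -> : mu = atomic_part mu by exact: atomic_part_tight.
apply/funext => E; apply/eqP; rewrite -subr_eq0; apply/eqP.
apply: (ca_eq0 immX (caD cam (caN cat))) => x /=.
by rewrite atomic_part1// subrr.
Qed.

Lemma tv_norm_fa_measure mu : fa_measure mu -> tv_norm mu = mu setT.
Proof.
move=> cmu; rewrite /tv_norm; set S := [set v | _].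
have SmuT : S (mu setT).
  exists 1%N, (fun=> setT); split; first by move=> i j _ _ _; rewrite (ord1 i) (ord1 j).
  by rewrite big_ord1 ger0_norm//; exact: cmu.2.
have ubS : ubound S (mu setT).
  move=> _ [n [F [tF ->]]].
  rewrite (eq_bigr (fun i => mu (F i))); last by move=> i _; rewrite ger0_norm//; exact: cmu.2.
  rewrite -(finitely_additive_bigsetU xpredT cmu.1) ?index_enum_uniq//.
    exact: fa_measure_le.
  move=> i j /eqP ij; apply: contrapT => /eqP/set0P ne.
  by apply: ij; apply: tF.
apply/eqP; rewrite eq_le; apply/andP; split; first by apply: ge_sup => //; exists (mu setT).
by apply: ub_le_sup => //; exists (mu setT).
Qed.

End yosida_hewitt.

(** * Kernel operators *)

Section kernels.
Context {R : realType} {X : choiceType}.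
Implicit Types (mu : set X -> R) (K : X -> set X -> R) (E F : set X).

Lemma kernel_bounded K (q : R) : (forall x, fa_measure (K x)) ->
  (forall x, K x setT = q) -> forall E, bounded_fun (K^~ E).
Proof.
move=> cK KT E; apply/bounded_mapP; exists q => x.
rewrite ger0_norm; last exact: (cK x).2.
by rewrite -(KT x) fa_measure_le.
Qed.

Section kernel.
Context (K : X -> set X -> R) (q : R) (cK : forall x, fa_measure (K x))
  (KT : forall x, K x setT = q).
Let bK := kernel_bounded cK KT.

Lemma kernel_op_setT mu : fa_measure mu -> kernel_op K mu setT = q * mu setT.
Proof.
move=> cmu; rewrite -radon_cst// /kernel_op; congr radon_integral.
by apply/funext.
Qed.

Lemma kernel_op_fa_measure mu : fa_measure mu -> fa_measure (kernel_op K mu).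
Proof.
move=> cmu; split=> [A B AB|E]; rewrite /kernel_op.
  rewrite -radonD//; congr radon_integral; apply/funext => x /=.
  exact: (cK x).1.
rewrite -(mul0r (mu setT)) -radon_cst//; apply: radon_le => //.
  exact: bounded_fun_cst.
by move=> x; exact: (cK x).2.
Qed.

Lemma kernel_op_set1 mu x : fa_measure mu -> (forall y, K y [set x] = 0) ->
  kernel_op K mu [set x] = 0.
Proof.
move=> cmu K0; rewrite /kernel_op (_ : (fun _ => _) = cst 0); last by apply/funext.
by rewrite radon_cst// mul0r.
Qed.

Lemma kernel_opD mu nu : fa_measure mu -> fa_measure nu ->
  kernel_op K (mu \+ nu) = kernel_op K mu \+ kernel_op K nu.
Proof.
by move=> cmu cnu; apply/funext => E; rewrite /kernel_op radon_measureD.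
Qed.

(** For [mu] nearly carried by a finite [F], the tails of the finitely many
    measures [K x], [x] in [F], are small outside a common finite set [H]; the
    points outside [F] contribute at most [q * mu (~` F)]. *)
Lemma kernel_op_tight mu : (forall x, tight (K x)) ->
  fa_measure mu -> tight mu -> tight (kernel_op K mu).
Proof.
move=> tK cmu tmu e e0.
have m0 : 0 <= mu setT by exact: cmu.2.
pose d := e / (mu setT + `|q| + 1).
have D0 : 0 < mu setT + `|q| + 1 by have := normr_ge0 q; lra.
have d0 : 0 < d by rewrite divr_gt0.
have de : e = d * (mu setT + `|q| + 1) by rewrite divfK ?gt_eqF.
have [F fF Fd] := tmu d d0.
have /choice[G GP] : forall x, exists G, finite_set G /\ K x (~` G) <= d.
  by move=> x; have [G ? ?] := tK x d d0; exists G.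
pose H := \bigcup_(x in F) G x.
exists H; first by apply: bigcup_finite => // x _; exact: (GP x).1.
have bI : bounded_fun (fun x => d + `|q| * \1_(~` F) x).
  apply/bounded_mapP; exists (d + `|q|) => x; rewrite indicE.
  by case: (_ \in _); rewrite /= ?mulr1 ?mulr0 ger0_norm; have := normr_ge0 q; lra.
have : kernel_op K mu (~` H) <= radon_integral mu (fun x => d + `|q| * \1_(~` F) x).
  apply: radon_le => // x; have [xF|xF] := pselect (F x).
    rewrite indicE memNset ?mulr0 ?addr0//.
    apply: le_trans _ (GP x).2; apply: fa_measure_le => //.
    by apply: subsetC => y Gy; exists x.
  rewrite indicE mem_set// mulr1; apply: (@le_trans _ _ q).
    by rewrite -(KT x) fa_measure_le.
  by apply: le_trans (ler_norm _) _; rewrite lerDr ltW.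
rewrite (_ : (fun x => _) = cst d \+ (fun x => `|q| * \1_(~` F) x))//.
rewrite radonD ?radon_cst ?radon_scale_indic//; [|exact: bounded_fun_cst|].
  by have := normr_ge0 q; rewrite [in X in _ -> X]de; nra.
apply/bounded_mapP; exists `|q| => x.
by rewrite indicE normrM normr_id ger0_norm// ler_piMr// lern1 leq_b1.
Qed.

End kernel.
End kernels.

(** * Banach limits *)

Section banach_limit.
Context {R : realType}.
Implicit Types (u v : R^nat) (L : R^nat -> R).

Record banach_limit L : Prop := {
  banach_limitD : forall u v, bounded_fun u -> bounded_fun v ->
    L (u \+ v) = L u + L v;
  banach_limitZ : forall c u, bounded_fun u -> L (fun k => c * u k) = c * L u;
  banach_limit_ge0 : forall u, bounded_fun u -> (forall k, 0 <= u k) -> 0 <= L u;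
  banach_limit_cst : forall c, L (cst c) = c;
  banach_limit_shift : forall u, bounded_fun u -> L (fun k => u k.+1) = L u }.

(** A cluster point of an ultrafilter is a limit of it, and compactness of
    [[- M, M]] provides a cluster point. *)
Lemma ultra_bounded_cvg (U : set_system nat) u : UltraFilter U ->
  bounded_fun u -> cvg (u @ U).
Proof.
move=> ultraU /bounded_mapP[M uM].
have UM : (u @ U) [set` `[- M, M]].
  by apply: (@filterE _ U) => k; rewrite /= in_itv/= -ler_norml uM.
have [l [_ ul]] := @segment_compact R (- M) M (u @ U) _ UM.
apply/cvg_ex; exists l => A Al.
have [//|UnA] := in_ultra_setVsetC (u @^-1` A) ultraU.
by have [y [/= ny Ay]] := ul (~` A) A UnA Al.
Qed.

Definition cesaro u : R^nat := fun n => (\sum_(k < n.+1) u k) / n.+1%:R.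

Lemma cesaro_bounded u : bounded_fun u -> bounded_fun (cesaro u).
Proof.
move=> /bounded_mapP[M uM]; apply/bounded_mapP; exists M => n.
rewrite /cesaro normrM normfV [X in _ / X]ger0_norm// ler_pdivrMr//.
apply: le_trans (ler_norm_sum _ _ _) _.
apply: (@le_trans _ _ (\sum_(k < n.+1) M)); first exact: ler_sum.
by rewrite sumr_const card_ord mulr_natr.
Qed.

(** The limit of the Cesaro means along a nonprincipal ultrafilter.  Shifting
    [u] changes the [n]-th mean by [(u n.+1 - u 0) / n.+1], which tends to 0. *)
Lemma exists_banach_limit : exists L, banach_limit L.
Proof.
have [U [ultraU ooU]] := @ultraFilterLemma nat \oo _.
have cv u : bounded_fun u -> cvg (cesaro u @ U).
  by move=> bu; exact: ultra_bounded_cvg (cesaro_bounded bu).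
exists (fun u => lim (cesaro u @ U)); split.
- move=> u v bu bv; rewrite (_ : cesaro _ = cesaro u \+ cesaro v).
    by rewrite limD//; exact: cv.
  by apply/funext => n; rewrite /cesaro big_split mulrDl.
- move=> c u bu; rewrite (_ : cesaro _ = (fun n => c * cesaro u n)).
    by apply: cvg_lim => //; apply: cvgM; [exact: cvg_cst|exact: cv].
  by apply/funext => n; rewrite /cesaro -mulr_sumr mulrA.
- move=> u bu u0; apply: limr_ge; first exact: cv.
  by apply: nearW => n; rewrite divr_ge0// sumr_ge0.
- move=> c; rewrite (_ : cesaro _ = cst c); first exact: lim_cst.
  apply/funext => n; rewrite /cesaro sumr_const card_ord/= -(mulr_natr c) mulfK//.
- move=> u bu; have bSu : bounded_fun (fun k => u k.+1).
    by move/bounded_mapP: bu => [M uM]; apply/bounded_mapP; exists M.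
  apply/eqP; rewrite -subr_eq0 -limB; [|exact: cv|exact: cv].
  apply/eqP/cvg_lim => //; apply: (@cvg_trans _ ((cesaro (fun k => u k.+1) \- cesaro u) @ \oo)).
    exact: cvg_app.
  move/bounded_mapP: bu => [M uM].
  apply: (@squeeze_cvgr _ _ _ _ (fun n => - (2 * M * harmonic n)) (fun n => 2 * M * harmonic n)).
  + apply: nearW => n /=; rewrite -ler_norml /cesaro -mulrBl -sumrB.
    rewrite -(big_mkord xpredT (fun k => u k.+1 - u k)) telescope_sumr//.
    rewrite normrM normfV [X in _ / X]ger0_norm// ler_wpM2r ?invr_ge0//.
    by apply: le_trans (ler_normB _ _) _; have := uM 0%N; have := uM n.+1; lra.
  + rewrite -[X in _ --> X]oppr0; apply: cvgN; rewrite -[X in _ --> X](mulr0 (2 * M)).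
    by apply: cvgM; [exact: cvg_cst|exact: cvg_harmonic].
  + rewrite -[X in _ --> X](mulr0 (2 * M)).
    by apply: cvgM; [exact: cvg_cst|exact: cvg_harmonic].
Qed.

Lemma banach_limit_dist L u v (e : R) : banach_limit L ->
  bounded_fun u -> bounded_fun v -> (forall k, `|u k - v k| <= e) ->
  `|L u - L v| <= e.
Proof.
move=> bL bu bv uv.
have le_L (w z : R^nat) : bounded_fun w -> bounded_fun z -> (forall k, w k <= z k + e) ->
    L w <= L z + e.
  move=> bw bz wz.
  have bz' : bounded_fun (z \+ cst e : nat -> R).
    apply: (@bounded_funD _ _ z (cst e)) => //; exact: bounded_fun_cst.
  have bw' : bounded_fun (fun k => -1 * w k).
    move/bounded_mapP: bw => [M wM]; apply/bounded_mapP; exists M => k.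
    by rewrite mulN1r normrN.
  have : 0 <= L ((z \+ cst e) \+ (fun k => -1 * w k)).
    apply: banach_limit_ge0 => // [|k /=]; first exact: bounded_funD.
    by rewrite mulN1r subr_ge0.
  rewrite !banach_limitD// ?banach_limitZ// ?banach_limit_cst//; last exact: bounded_fun_cst.
  lra.
have := le_L u v bu bv; have := le_L v u bv bu.
rewrite ler_norml => h1 h2; apply/andP; split.
  suff : L v <= L u + e by lra.
  by apply: h1 => k; have := uv k; rewrite ler_norml => /andP[]; lra.
suff : L u <= L v + e by lra.
by apply: h2 => k; have := uv k; rewrite ler_norml => /andP[]; lra.
Qed.

End banach_limit.

(** * Limits of sequences of measures along a Banach limit *)

Section measure_limit.
Context {R : realType} {X : choiceType} (L : R^nat -> R) (m : nat -> set X -> R)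
  (bL : banach_limit L) (cm : forall k, fa_measure (m k))
  (m1 : forall k, m k setT = 1).
Implicit Types (f s : X -> R).

Definition limit_measure : set X -> R := fun E => L (fun k => m k E).

Lemma measure_seq_bounded E : bounded_fun (fun k => m k E).
Proof.
apply/bounded_mapP; exists 1 => k.
rewrite ger0_norm; last exact: (cm k).2.
by rewrite -(m1 k) fa_measure_le.
Qed.

Lemma limit_measure_fa_measure : fa_measure limit_measure.
Proof.
split=> [A B AB|E]; last first.
  by apply: banach_limit_ge0 => // [|k]; [exact: measure_seq_bounded|exact: (cm k).2].
rewrite /limit_measure -(banach_limitD bL); try exact: measure_seq_bounded.
by congr L; apply/funext => k; exact: (cm k).1.
Qed.

Lemma limit_measure_setT : limit_measure setT = 1.
Proof.
rewrite /limit_measure (_ : (fun k => _) = cst 1); last by apply/funext.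
exact: banach_limit_cst.
Qed.

Lemma simple_integral_limit s : simple_fun s ->
  bounded_fun (fun k => simple_integral (m k) s) /\
  simple_integral limit_measure s = L (fun k => simple_integral (m k) s).
Proof.
move=> ss; have [r _ sr] := simple_integral_range ss.
rewrite sr; last exact: limit_measure_fa_measure.1.
rewrite (_ : (fun k => _) = (fun k => \sum_(y <- r) y * m k (s @^-1` [set y]))); last first.
  by apply/funext => k; rewrite sr//; exact: (cm k).1.
elim: r {sr} => [|y r [IHb IHr]].
  rewrite big_nil (_ : (fun k => _) = cst 0); last by apply/funext => k; rewrite big_nil.
  by rewrite banach_limit_cst//; split=> //; exact: bounded_fun_cst.
rewrite big_cons IHr (_ : (fun k => \sum_(_ <- _ :: _) _) =
   (fun k => y * m k (s @^-1` [set y])) \+ (fun k => \sum_(y <- r) y * m k (s @^-1` [set y]))).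
  have by_ : bounded_fun (fun k => y * m k (s @^-1` [set y])).
    have /bounded_mapP[M hM] := measure_seq_bounded (s @^-1` [set y]).
    by apply/bounded_mapP; exists (`|y| * M) => k; rewrite normrM ler_wpM2l.
  split; first exact: bounded_funD.
  by rewrite (banach_limitD bL)// banach_limitZ//; exact: measure_seq_bounded.
by apply/funext => k; rewrite big_cons.
Qed.

(** The error of a uniform approximation of [f] by a simple function is bounded
    by the total mass 1, uniformly in [k], so it survives the limit. *)
Lemma radon_limit f : bounded_fun f ->
  radon_integral limit_measure f = L (fun k => radon_integral (m k) f).
Proof.
move=> bf.
have br : bounded_fun (fun k => radon_integral (m k) f).
  have /bounded_mapP[M fM] := bf; apply/bounded_mapP; exists M => k.
  rewrite ler_norml -(mulr1 M) -mulNr -(m1 k) -!radon_cst//.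
  apply/andP; split; apply: radon_le => //; try exact: bounded_fun_cst.
    by move=> x; have := fM x; rewrite ler_norml => /andP[].
  by move=> x; have := fM x; rewrite ler_norml => /andP[].
apply: (@radon_unique _ _ _ _ 1); first exact: limit_measure_fa_measure.
move=> e e0; have [s ss fs] := simple_approx bf e0; exists s; split=> //.
have [bs ->] := simple_integral_limit ss.
rewrite mul1r; apply: banach_limit_dist => // k.
by rewrite -[leRHS]mul1r -(m1 k); exact: radon_approx.
Qed.

End measure_limit.

(** * Invariant measures *)

Lemma markov_kernel_fa_measure {R : realType} {X : choiceType}
    (P : X -> set X -> R) : fa_markov_kernel P -> forall x, fa_measure (P x).
Proof.
by move=> [P01 _ baP _] x; split=> [|E]; [exact: (baP x).1|case/andP: (P01 x E)].
Qed.

(** The Banach limit of an orbit is a fixed point, as the operator commutes with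
    the limit and shifts the orbit by one. *)
Lemma exists_invariant_probability {R : realType} {X : choiceType}
    (P : X -> set X -> R) (x0 : X) : fa_markov_kernel P ->
  exists mu, invariant_probability P mu.
Proof.
move=> kP; have cP := markov_kernel_fa_measure kP; have [_ _ _ P1] := kP.
have [L bL] := @exists_banach_limit R.
pose m k := iter k (kernel_op P) (P x0).
have mP k : fa_measure (m k) /\ m k setT = 1.
  elim: k => [|k [cm m1]] /=; first by split; [exact: cP|exact: P1].
  by split; [exact (kernel_op_fa_measure cP P1 cm)|rewrite (kernel_op_setT P1)// m1 mulr1].
have cm k := (mP k).1; have m1 k := (mP k).2.
have cmu := limit_measure_fa_measure bL cm m1.
have mu1 := limit_measure_setT bL m1.
exists (limit_measure L m); split.
  by split=> //; split; [exact: fa_measure_ba|exact: cmu.2|rewrite mu1].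
apply/funext => E; rewrite /kernel_op (radon_limit bL cm m1); last first.
  exact: kernel_bounded cP P1 E.
by rewrite /limit_measure -(banach_limit_shift bL)//; exact: measure_seq_bounded cm m1 E.
Qed.

Theorem corollary5p1 (R : realType) (X : choiceType)
    (X_infinite : infinite_set [set: X])
    (X_immeasurable : immeasurable R X)
    (P P_ca P_pfa : X -> set X -> R) (q1 q2 : R)
    (P_kernel : fa_markov_kernel P)
    (P_decomposition : kernel_decomposition P P_ca P_pfa)
    (P_combined : combined P_ca P_pfa q1 q2)
    (P_nondegenerate : non_degenerate q1 q2)
    (A_ca_V_pfa : kernel_op P_ca @` V pfa `<=` V ca) :
  (exists mu : set X -> R, invariant_probability P mu) /\
  (forall mu : set X -> R, invariant_probability P mu ->
     (exists mu_ca mu_pfa : set X -> R, ca_pfa_decomposition mu mu_ca mu_pfa) /\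
     (forall mu_ca mu_pfa : set X -> R,
        ca_pfa_decomposition mu mu_ca mu_pfa ->
        (tv_norm mu_ca = mu_ca setT /\ mu_ca setT = q1) /\
        (tv_norm mu_pfa = mu_pfa setT /\ mu_pfa setT = q2))).
Proof.
have cP := markov_kernel_fa_measure P_kernel; have [_ _ _ P1] := P_kernel.
have [_ _ q12 Pca1 Ppfa1] := P_combined.
split.
  have [x0 _] : [set: X] !=set0.
    by apply/set0P; apply/eqP => X0; apply: X_infinite; rewrite X0.
  exact: exists_invariant_probability x0 P_kernel.
move=> mu [[[bmu mu0 _] mu1] mu_inv].
have cmu : fa_measure mu by split; [exact: bmu.1|].
split; first by exists (atomic_part mu), (mu \- atomic_part mu); exact: decomposition_atomic.
have cca x : fa_measure (P_ca x).
  have [-> _] := decomposition_unique X_immeasurable (cP x) (P_decomposition x).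
  exact: atomic_part_fa_measure.
have cpfa x : fa_measure (P_pfa x).
  have [_ ->] := decomposition_unique X_immeasurable (cP x) (P_decomposition x).
  exact: diffuse_part_fa_measure.
have [caat pfadi muE] := decomposition_atomic X_immeasurable cmu.
have cat := atomic_part_fa_measure cmu; have cdi := diffuse_part_fa_measure cmu.
have A_split : mu = kernel_op P_ca mu \+ kernel_op P_pfa mu.
  rewrite {1}mu_inv; apply/funext => E; rewrite /kernel_op /= -radonD//; last 2 first.
  - exact: kernel_bounded cca Pca1 E.
  - exact: kernel_bounded cpfa Ppfa1 E.
  by congr radon_integral; apply/funext => x; have [_ _ ->] := P_decomposition x.
have ca_Aca : ca (kernel_op P_ca mu).
  rewrite muE (kernel_opD cca Pca1 cat cdi); apply: caD.
    apply: tight_ca; first exact (kernel_op_fa_measure cca Pca1 cat).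
    have tca x : tight (P_ca x).
      by have [? _ _] := P_decomposition x; exact: ca_tight.
    exact (kernel_op_tight cca Pca1 tca cat (atomic_part_tight cmu)).
  have : V ca (kernel_op P_ca (mu \- atomic_part mu)).
    apply: A_ca_V_pfa; exists (mu \- atomic_part mu) => //; split=> //.
      exact: cdi.2.
    by rewrite /= mu1 lerBlDr lerDl; exact: cat.2.
  by case.
have pfa_Apfa : pfa (kernel_op P_pfa mu).
  apply: diffuse_pfa => //; first exact (kernel_op_fa_measure cpfa Ppfa1 cmu).
  move=> y; apply: kernel_op_set1 => // x.
  by have [_ ? _] := P_decomposition x; exact: pfa_set1.
(* Invariance exhibits a second decomposition of mu. *)
have dA : ca_pfa_decomposition mu (kernel_op P_ca mu) (kernel_op P_pfa mu) by split.
have [Aca Apfa] := decomposition_unique X_immeasurable cmu dA.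
move=> mu_ca mu_pfa /(decomposition_unique X_immeasurable cmu)[-> ->].
rewrite !tv_norm_fa_measure//; split; split => //.
  by rewrite -Aca (kernel_op_setT Pca1)// mu1 mulr1.
by rewrite -Apfa (kernel_op_setT Ppfa1)// mu1 mulr1.
Qed.
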